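(* Let $(X,d_X)$ and $(Y,d_Y)$ be metric spaces with nets $(X_0,i_X,e_X)$ and $(Y_0,i_Y,e_Y)$ of $X$ and $Y$, respectively, and let $X\ast Y$ be their free product, equipped with its metric $d_\ast$. If both $X$ and $Y$ are coarsely embeddable into a Hilbert space, then $X\ast Y$ is also coarsely embeddable into a Hilbert space.
   Context: **Nets.** A net of a metric space $(X,d_X)$ is a triple $(X_0,i_X,e_X)$ where $X_0$ is a set, $i_X:X_0\to X$ is a map such that $i_X^{-1}(K)$ is finite for every compact $K\subseteq X$, and $e_X\in i_X(X_0)$ (the base point). Write $\overline{x_0}=i_X(x_0)$ for $x_0\in X_0$. **Words.** Given nets of $X$ and $Y$, choose $\epsilon_X\in X_0$, $\epsilon_Y\in Y_0$ with $i_X(\epsilon_X)=e_X$, $i_Y(\epsilon_Y)=e_Y$; put $X_0^*=X_0\setminus\{\epsilon_X\}$, $Y_0^*=Y_0\setminus\{\epsilon_Y\}$. A normal word is a finite sequence $w_0w_1\cdots w_n$ ($n\ge 0$) of elements of $X_0^*\sqcup Y_0^*$ whose letters alternate between $X_0^*$ and $Y_0^*$. Let $\epsilon$ be the empty word. $W$ is the set of all normal words together with $\epsilon$; $W_X$ (resp. $W_Y$) consists of $\epsilon$ and all normal words whose last letter is not in $X_0^*$ (resp. not in $Y_0^*$). **Free product.** Let $$\widetilde{X\ast Y}=(W_X\times X)\sqcup(W_Y\times Y)\sqcup(W_X\times X_0^*\times[0,1])\sqcup(W_Y\times Y_0^*\times[0,1])\sqcup(\{\epsilon\}\times[0,1]).$$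 Let $\sim$ be the equivalence relation generated by: (i) the point $(\epsilon,e_X)\in W_X\times X$ is identified with $(\epsilon,0)\in\{\epsilon\}\times[0,1]$, and $(\epsilon,e_Y)\in W_Y\times Y$ with $(\epsilon,1)\in\{\epsilon\}\times[0,1]$; (ii) for $\omega\in W_X$, $x_0\in X_0^*$: $(\omega,\overline{x_0})\sim(\omega,x_0,0)$ and $(\omega x_0,e_Y)\sim(\omega,x_0,1)$, where $(\omega,\overline{x_0})\in W_X\times X$ and $(\omega x_0,e_Y)\in W_Y\times Y$; (iii) for $\tau\in W_Y$, $y_0\in Y_0^*$: $(\tau,\overline{y_0})\sim(\tau,y_0,0)$ and $(\tau y_0,e_X)\sim(\tau,y_0,1)$, where $(\tau,\overline{y_0})\in W_Y\times Y$ and $(\tau y_0,e_X)\in W_X\times X$. The free product is $X\ast Y=\widetilde{X\ast Y}/\sim$. The sets $\{\omega\}\times X$ ($\omega\in W_X$) and $\{\tau\}\times Y$ ($\tau\in W_Y$) are called sheets; the sets $\{\epsilon\}\times[0,1]$, $\{\omega\}\times\{x_0\}\times[0,1]$, $\{\tau\}\times\{y_0\}\times[0,1]$ are called edges. The sheets (as vertices) and edges form a tree. **Metric $d_\ast$.** Each sheet carries the metric $d_X$ or $d_Y$, and each edge carries the metric $|t_1-t_2|$ of $[0,1]$. The metric $d_\ast$ on $X\ast Y$ is the shortest-path distance: $d_\ast(p,q)$ is the infimum of $\sum_{i=1}^n d_{C_i}(p_{i-1},p_i)$ over all finite chains $p=p_0,p_1,\dots,p_n=q$ in which $p_{i-1},p_i$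 lie in a common sheet or edge $C_i$ with metric $d_{C_i}$. (By the tree structure it is attained along the unique route between $p$ and $q$; e.g. for $p=(x_0y_0,u)$ and $q=(\epsilon,v)$ with $u,v\in X$, $d_\ast(p,q)=d_X(v,\overline{x_0})+1+d_Y(\overline{y_0},e_Y)+1+d_X(e_X,u)$.) **Coarse embeddability.** A metric space $(Z,d)$ is coarsely embeddable into a Hilbert space if there exist a Hilbert space $\mathcal{H}$, a map $F:Z\to\mathcal{H}$ and non-decreasing functions $\rho_1,\rho_2:\mathbb{R}_+\to\mathbb{R}$ with $\lim_{t\to+\infty}\rho_i(t)=+\infty$ ($i=1,2$) such that $\rho_1(d(x,y))\le\|F(x)-F(y)\|\le\rho_2(d(x,y))$ for all $x,y\in Z$. *)

(* Defs.v *)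
From HB Require Import structures.
From Stdlib Require Import Relation_Operators.
From mathcomp Require Import all_boot all_order all_algebra.
From mathcomp Require Import all_classical all_reals all_analysis.
Set Implicit Arguments.
Unset Strict Implicit.
Unset Printing Implicit Defensive.
Import Order.TTheory GRing.Theory Num.Theory.
Import numFieldNormedType.Exports.
Local Open Scope classical_set_scope.
Local Open Scope ring_scope.
Local Open Scope quotient_scope.

(* The Hilbert space is a complete normed module [H] over the reals whose norm
   comes from the positive definite symmetric bilinear form [dot].  The
   functions [rho1] and [rho2] matter only on the nonnegative reals. *)
Definition coarsely_embeddable (R : realType) (Z : Type) (d : Z -> Z -> R) :
    Prop :=
  exists (H : completeNormedModType R) (dot : {dot H for idfun}),
    (forall h : H, `|h| ^+ 2 = dot h h) /\
    exists (F : Z -> H) (rho1 rho2 : R -> R),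
      [/\ {in Num.nneg &, {homo rho1 : s t / s <= t}},
          {in Num.nneg &, {homo rho2 : s t / s <= t}},
          rho1 t @[t --> +oo] --> +oo,
          rho2 t @[t --> +oo] --> +oo
        & forall x y, rho1 (d x y) <= `|F x - F y| <= rho2 (d x y)].

Record net (R : realType) (X : metricType R) := Net {
  net_set :> Type;
  net_map : net_set -> X;
  net_finite : forall K : set X, compact K -> finite_set (net_map @^-1` K);
  net_base : X;
  net_baseP : range net_map net_base }.

Section FreeProduct.
Context (R : realType) (X Y : metricType R) (NX : net X) (NY : net Y).
Context (epsX : NX) (epsY : NY).

Definition starX := {x0 : NX | x0 <> epsX}.
Definition starY := {y0 : NY | y0 <> epsY}.

Definition letter := (starX + starY)%type.

Definition is_X (l : letter) : bool := if l is inl _ then true else false.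

Definition alternates (l m : letter) : bool := is_X l != is_X m.

Definition alternating (w : seq letter) : bool := sorted alternates w.

Definition ends_in_X (w : seq letter) : bool := last false (map is_X w).
Definition ends_in_Y (w : seq letter) : bool := last false (map (negb \o is_X) w).

Definition WX := {w : seq letter | alternating w && ~~ ends_in_X w}.
Definition WY := {w : seq letter | alternating w && ~~ ends_in_Y w}.

Definition emptyX : WX := exist _ [::] isT.
Definition emptyY : WY := exist _ [::] isT.

Lemma rcons_normal (w : seq letter) (l : letter) :
  alternating (rcons w l) =
  alternating w && ~~ (if is_X l then ends_in_X w else ends_in_Y w).
Proof.
rewrite /alternating /ends_in_X /ends_in_Y; case: w => [|m w] /=.
  by rewrite if_same.
rewrite rcons_path !last_map (last_map (negb \o is_X)) /alternates /=.
by case: (is_X (last m w)); case: (is_X l).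
Qed.

Lemma extendX_subproof (w : WX) (x0 : starX) :
  alternating (rcons (val w) (inl x0)) && ~~ ends_in_Y (rcons (val w) (inl x0)).
Proof.
by rewrite rcons_normal (valP w) /ends_in_Y map_rcons last_rcons.
Qed.

Lemma extendY_subproof (w : WY) (y0 : starY) :
  alternating (rcons (val w) (inr y0)) && ~~ ends_in_X (rcons (val w) (inr y0)).
Proof.
by rewrite rcons_normal (valP w) /ends_in_X map_rcons last_rcons.
Qed.

Definition extendX (w : WX) (x0 : starX) : WY :=
  exist _ (rcons (val w) (inl x0)) (extendX_subproof w x0).
Definition extendY (w : WY) (y0 : starY) : WX :=
  exist _ (rcons (val w) (inr y0)) (extendY_subproof w y0).

Inductive pre_product : Type :=
| SheetX of WX & X
| SheetY of WY & Y
| EdgeX of WX & starX & {i01 R}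
| EdgeY of WY & starY & {i01 R}
| EdgeBase of {i01 R}.

HB.instance Definition _ := gen_eqMixin pre_product.
HB.instance Definition _ := gen_choiceMixin pre_product.

Inductive glue : pre_product -> pre_product -> Prop :=
| GlueBaseX : glue (SheetX emptyX (net_base NX)) (EdgeBase 0%:i01)
| GlueBaseY : glue (SheetY emptyY (net_base NY)) (EdgeBase 1%:i01)
| GlueX0 w (x0 : starX) :
    glue (SheetX w (net_map (sval x0))) (EdgeX w x0 0%:i01)
| GlueX1 w (x0 : starX) :
    glue (SheetY (extendX w x0) (net_base NY)) (EdgeX w x0 1%:i01)
| GlueY0 w (y0 : starY) :
    glue (SheetY w (net_map (sval y0))) (EdgeY w y0 0%:i01)
| GlueY1 w (y0 : starY) :
    glue (SheetX (extendY w y0) (net_base NX)) (EdgeY w y0 1%:i01).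

Definition glued (p q : pre_product) : bool :=
  `[< clos_refl_sym_trans _ glue p q >].

Lemma glued_equiv : equiv_class_of glued.
Proof.
split=> [p|p q|q p r].
- by apply/asboolP; exact: rst_refl.
- by apply/asboolP/asboolP; exact: rst_sym.
- by move=> /asboolP pq /asboolP qr; apply/asboolP; exact: rst_trans qr.
Qed.

Definition glued_rel : equiv_rel pre_product := EquivRelPack glued_equiv.

Definition free_product := {eq_quot glued_rel}.

Definition cls (p : pre_product) : free_product := \pi_free_product p.

(* [hop p q l]: [p] and [q] lie in a common sheet or edge, at distance [l]. *)
Inductive hop : free_product -> free_product -> R -> Prop :=
| HopX w x x' : hop (cls (SheetX w x)) (cls (SheetX w x')) (mdist x x')
| HopY w y y' : hop (cls (SheetY w y)) (cls (SheetY w y')) (mdist y y')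
| HopEdgeX w x0 (s t : {i01 R}) :
    hop (cls (EdgeX w x0 s)) (cls (EdgeX w x0 t)) `|s%:num - t%:num|
| HopEdgeY w y0 (s t : {i01 R}) :
    hop (cls (EdgeY w y0 s)) (cls (EdgeY w y0 t)) `|s%:num - t%:num|
| HopEdgeBase (s t : {i01 R}) :
    hop (cls (EdgeBase s)) (cls (EdgeBase t)) `|s%:num - t%:num|.

Inductive chain : free_product -> free_product -> R -> Prop :=
| ChainNil p : chain p p 0
| ChainCons p q r l m : hop p q l -> chain q r m -> chain p r (l + m).

Definition dstar (p q : free_product) : R := inf [set l | chain p q l].

(* The next lemmas show that the infimum above is that of a nonempty set
   bounded below, so it never takes the default value of [inf]. *)
Lemma hop_ge0 p q l : hop p q l -> 0 <= l.
Proof. by case=> *; rewrite ?mdist_ge0 ?normr_ge0. Qed.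

Lemma chain_ge0 p q l : chain p q l -> 0 <= l.
Proof. by elim=> // ? ? ? ? ? /hop_ge0 ? _ ?; rewrite addr_ge0. Qed.

Lemma hop_sym p q l : hop p q l -> hop q p l.
Proof.
case=> [w x x'|w y y'|w x0 s t|w y0 s t|s t].
- by rewrite metric_sym; exact: HopX.
- by rewrite metric_sym; exact: HopY.
- by rewrite distrC; exact: HopEdgeX.
- by rewrite distrC; exact: HopEdgeY.
- by rewrite distrC; exact: HopEdgeBase.
Qed.

Let linked p q := exists l, chain p q l.

Let linked_trans p q r : linked p q -> linked q r -> linked p r.
Proof.
move=> [l pq]; elim: pq r => // {}p q1 q2 l1 l2 h _ IH r /IH[m c].
by exists (l1 + m); exact: ChainCons h c.
Qed.

Let hop_linked p q l : hop p q l -> linked p q.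
Proof. by move=> h; exists (l + 0); exact: ChainCons h (ChainNil q). Qed.

Let linked_sym p q : linked p q -> linked q p.
Proof.
move=> [l]; elim=> [r|p1 q1 r l1 l2 /hop_sym/hop_linked h _ IH].
  by exists 0; exact: ChainNil.
exact: linked_trans IH h.
Qed.

Let glueP p q : glue p q -> cls p = cls q.
Proof. by move=> g; apply/eqmodP/asboolP; exact: rst_step. Qed.

Let base := cls (SheetX emptyX (net_base NX)).

Let sheets_linked n :
  (forall w x, size (sval w : seq letter) = n -> linked (cls (SheetX w x)) base) /\
  (forall w y, size (sval w : seq letter) = n -> linked (cls (SheetY w y)) base).
Proof.
elim: n => [|n [IHX IHY]]; split=> w z.
- move=> /size0nil w0; have -> : w = emptyX by exact/val_inj.
  exact: hop_linked (HopX _ _ _).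
- move=> /size0nil w0; have -> : w = emptyY by exact/val_inj.
  apply: linked_trans (hop_linked (HopY _ _ (net_base NY))) _.
  rewrite (glueP GlueBaseY) /base (glueP GlueBaseX).
  exact: hop_linked (HopEdgeBase _ _).
- case: w => w /=; case/lastP: w => // s [x0|y0] wP; rewrite size_rcons => -[sn].
    by exfalso; move: wP; rewrite /ends_in_X map_rcons last_rcons andbF.
  have sP : alternating s && ~~ ends_in_Y s by case/andP: wP; rewrite rcons_normal.
  have -> : exist _ (rcons s (inr y0)) wP = extendY (exist _ s sP) y0 by exact/val_inj.
  apply: linked_trans (hop_linked (HopX _ _ (net_base NX))) _.
  rewrite (glueP (GlueY1 _ _)).
  apply: linked_trans (hop_linked (HopEdgeY _ _ _ 0%:i01)) _.
  by rewrite -(glueP (GlueY0 _ _)); exact: IHY.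
- case: w => w /=; case/lastP: w => // s [x0|y0] wP; rewrite size_rcons => -[sn].
    have sP : alternating s && ~~ ends_in_X s by case/andP: wP; rewrite rcons_normal.
    have -> : exist _ (rcons s (inl x0)) wP = extendX (exist _ s sP) x0 by exact/val_inj.
    apply: linked_trans (hop_linked (HopY _ _ (net_base NY))) _.
    rewrite (glueP (GlueX1 _ _)).
    apply: linked_trans (hop_linked (HopEdgeX _ _ _ 0%:i01)) _.
    by rewrite -(glueP (GlueX0 _ _)); exact: IHX.
  by exfalso; move: wP; rewrite /ends_in_Y map_rcons last_rcons andbF.
Qed.

Lemma free_product_connected p q : exists l, chain p q l.
Proof.
suff to_base r : linked r base.
  exact: linked_trans (to_base p) (linked_sym (to_base q)).
elim/quotW: r => -[w x|w y|w x0 t|w y0 t|t].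
- by have [+ _] := sheets_linked (size (val w)); exact.
- by have [_ +] := sheets_linked (size (val w)); exact.
- apply: linked_trans (hop_linked (HopEdgeX _ _ _ 0%:i01)) _.
  rewrite -(glueP (GlueX0 _ _)).
  by have [+ _] := sheets_linked (size (val w)); exact.
- apply: linked_trans (hop_linked (HopEdgeY _ _ _ 0%:i01)) _.
  rewrite -(glueP (GlueY0 _ _)).
  by have [_ +] := sheets_linked (size (val w)); exact.
- by rewrite /base (glueP GlueBaseX); exact: hop_linked (HopEdgeBase _ _).
Qed.

Lemma dstar_has_inf p q : has_inf [set l | chain p q l].
Proof.
split; first by have [l c] := free_product_connected p q; exists l.
by exists 0 => l; exact: chain_ge0.
Qed.

End FreeProduct.

(* Main.v *)
Require Import Defs.
From HB Require Import structures.
From Stdlib Require Import Relation_Operators.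
From mathcomp Require Import all_boot all_order all_algebra.
From mathcomp Require Import all_classical all_reals all_analysis.
From mathcomp Require Import ring lra.

(** The sheets and edges of the free product form a tree, and every point has a
    coordinate on each of them: its nearest point on the sheet ([projX],
    [projY]), and the fraction of the edge that lies between it and the root
    ([crossing]).  The distance between two points is, up to an additive
    constant, the sum of their coordinate distances.  So let [FX] and [FY] be
    coarse embeddings of the two factors and send a point to the orthogonal sum
    of the [FX]-images of its coordinates on the sheets that are copies of [X],
    the [FY]-images of those on the copies of [Y], and its edge coordinates.

    Every point is within distance 1 of a sheet, so only points [p] and [q] of
    sheets matter.  Their coordinates differ only along the route between them
    ([route_exists]): on a set of [n] fully crossed edges and on at most [n + 2]
    sheets.
    - If [dstar p q <= r], then every coordinate distance on a sheet is at most
      [r], because the projections are short maps, and [n <= r], because the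
      crossed edges have total length [n]; both facts follow from [dstar] being
      the largest pseudo-metric dominated by the metrics of the cells
      ([dstar_largest]).  The squared distance of the images is thus a sum of at
      most [r + 2] bounded terms and at most [r] terms equal to 1.
    - If the images are at distance at most [c], then [n <= c ^+ 2], since each
      crossed edge contributes 1 to the squared distance, and each sheet
      distance is bounded because [FX] and [FY] are coarse; hence the route has
      bounded length.
    Mapping bounded distances to bounded distances in both directions is all
    that coarse embeddability asks ([coarse_map_embeddable]).

    The target is the l2 direct sum of a family of Hilbert spaces
    ([l2_hilbert]).  Its inner product is defined by polarization; bilinearity
    and the triangle inequality both come from the principle that a linear
    inequality between squared norms which holds in every coordinate holds for
    the sums ([sqnorm_form_ge0]). *)

Set Implicit Arguments.
Unset Strict Implicit.
Unset Printing Implicit Defensive.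
Import Order.TTheory GRing.Theory Num.Theory.
Import numFieldNormedType.Exports.
Local Open Scope classical_set_scope.
Local Open Scope ring_scope.

(** * Hilbert spaces *)

(** Bundling the form with the norm identity lets the canonical structures of a
    direct sum be inferred from the family of summands alone. *)
Record hilbertType (R : realType) := HilbertType {
  hilbert_sort :> completeNormedModType R;
  hilbert_dot : {dot hilbert_sort for idfun};
  hilbert_norm : forall h : hilbert_sort, `|h| ^+ 2 = hilbert_dot h h }.

Section HilbertTheory.
Context (R : realType) (H : hilbertType R).
Implicit Types (a b c : H) (s : R).

Lemma hilbert_normD a b :
  `|a + b| ^+ 2 = `|a| ^+ 2 + `|b| ^+ 2 + 2 * hilbert_dot H a b.
Proof.
by rewrite !hilbert_norm hnormD expr0 mul1r /= mulr_natl mulr2n.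
Qed.

Lemma hilbert_dotDl a b c :
  hilbert_dot H (a + b) c = hilbert_dot H a c + hilbert_dot H b c.
Proof. by rewrite linearDl. Qed.

Lemma hilbert_dotZl s a b : hilbert_dot H (s *: a) b = s * hilbert_dot H a b.
Proof. by rewrite linearZl. Qed.

End HilbertTheory.

Section RealLine.
Context (R : realType).

Definition real_dot (x y : R^o) : R := x * y.

Let real_dot_additivel y : zmod_morphism (real_dot^~ y).
Proof. by move=> a b; rewrite /real_dot mulrBl. Qed.
Let real_dot_additiver x : zmod_morphism (real_dot x).
Proof. by move=> a b; rewrite /real_dot mulrBr. Qed.
Let real_dot_scalel y : scalable_for *%R (real_dot^~ y).
Proof. by move=> a b; rewrite /real_dot mulrA. Qed.
Let real_dot_scaler x : scalable_for (idfun \; *%R) (real_dot x).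
Proof. by move=> a b; rewrite /real_dot /= mulrCA. Qed.
HB.instance Definition _ := @isBilinear.Build R R^o R^o R _ _ real_dot
  real_dot_additivel real_dot_additiver real_dot_scalel real_dot_scaler.

Let real_dotC (x y : R^o) : real_dot x y = (-1) ^+ false * idfun (real_dot y x).
Proof. by rewrite expr0 mul1r /= /real_dot mulrC. Qed.
HB.instance Definition _ :=
  @isHermitianSesquilinear.Build R R^o false idfun real_dot real_dotC.

Let real_dot_gt0 (x : R^o) : x != 0 -> 0 < real_dot x x.
Proof. by move=> x0; change (0 < (x : R) ^+ 2); rewrite exprn_even_gt0. Qed.
HB.instance Definition _ := @isDotProduct.Build R R^o real_dot real_dot_gt0.

Let real_dot_norm (x : R^o) : `|x| ^+ 2 = (real_dot : {dot R^o for idfun}) x x.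
Proof. by rewrite real_normK ?num_real. Qed.

Definition real_hilbert : hilbertType R :=
  @HilbertType R R^o (real_dot : {dot R^o for idfun}) real_dot_norm.

End RealLine.

(** * l2 direct sums *)
Lemma esumZ (R : realType) (I : choiceType) (c : R) (a : I -> R) :
  0 <= c -> (forall i, 0 <= a i) ->
  (\esum_(i in [set: I]) (c * a i)%:E =
   c%:E * \esum_(i in [set: I]) (a i)%:E)%E.
Proof.
move=> c0 a0.
have le_esumZ (k : R) (b : I -> R) : 0 <= k -> (forall i, 0 <= b i) ->
    (\esum_(i in [set: I]) (k * b i)%:E <=
     k%:E * \esum_(i in [set: I]) (b i)%:E)%E.
  move=> k0 b0; apply: ge_ereal_sup => _ [A fA <-].
  under eq_fsbigr do rewrite EFinM.
  rewrite -ge0_mule_fsumr; last by move=> i; rewrite lee_fin.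
  by rewrite lee_wpmul2l ?lee_fin// ereal_sup_ubound//; exists A.
apply/eqP; rewrite eq_le le_esumZ //=.
have [->|cn0] := eqVneq c 0.
  by rewrite mul0e esum_ge0// => i _; rewrite mul0r.
have cp : 0 < c by rewrite lt_def cn0.
rewrite -(@lee_pmul2l _ c^-1%:E) ?lte_fin ?invr_gt0 //.
rewrite muleA -EFinM mulVf // mul1e.
have := le_esumZ c^-1 (fun i => c * a i).
under eq_esum do rewrite mulrA mulVf // mul1r.
by apply; [rewrite invr_ge0|move=> i; rewrite mulr_ge0].
Qed.

Section SquareSummable.
Context (R : realType) (I : choiceType) (H : I -> hilbertType R).

Definition sqsum (f : forall i, H i) : \bar R :=
  \esum_(i in [set: I]) (`|f i| ^+ 2)%:E.

Lemma sqsum_ge0 f : (0 <= sqsum f)%E.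
Proof. by apply: esum_ge0 => i _; rewrite lee_fin exprn_ge0. Qed.

Lemma sqsum_ge f (s : seq I) : uniq s ->
  ((\sum_(i <- s) `|f i| ^+ 2)%:E <= sqsum f)%E.
Proof.
move=> us; apply: esum_ge; exists [set` s].
  by split=> //; exact: finite_seq.
by rewrite -(@fsbig_seq _ _ _ _ _ _ us) // sumEFin.
Qed.

Lemma sqsum_le f (c : \bar R) :
  (forall s, uniq s -> ((\sum_(i <- s) `|f i| ^+ 2)%:E <= c)%E) ->
  (sqsum f <= c)%E.
Proof.
move=> h; apply: ge_ereal_sup => _ [A [fA _] <-].
by rewrite fsbig_finite // sumEFin h.
Qed.

Record l2 := L2 { l2_fun :> forall i, H i; l2_finite : (sqsum l2_fun < +oo)%E }.

HB.instance Definition _ := gen_eqMixin l2.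
HB.instance Definition _ := gen_choiceMixin l2.

Implicit Types f g h : l2.

Lemma l2_ext f g : (forall i, f i = g i) -> f = g.
Proof.
case: f g => f fP [g gP] /= fg.
have {}fg : f = g by exact: functional_extensionality_dep.
by case: _ / fg gP => gP; congr L2; exact: Prop_irrelevance.
Qed.

Definition sqnorm f : R := fine (sqsum f).

Lemma sqsumE f : sqsum f = (sqnorm f)%:E.
Proof.
by rewrite fineK // ge0_fin_numE ?sqsum_ge0 ?l2_finite.
Qed.

Lemma sqnorm_ge f (s : seq I) : uniq s ->
  \sum_(i <- s) `|f i| ^+ 2 <= sqnorm f.
Proof. by move=> us; rewrite -lee_fin -sqsumE sqsum_ge. Qed.

Lemma sqnorm_ge0 f : 0 <= sqnorm f.
Proof. by have := @sqnorm_ge f [::] isT; rewrite big_nil. Qed.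

Let esum_sqnorm (s : seq (R * l2)) : (forall k, k \in map fst s -> 0 <= k) ->
  (\esum_(i in [set: I]) (\sum_(k <- s) k.1 * `|k.2 i| ^+ 2)%:E =
   (\sum_(k <- s) k.1 * sqnorm k.2)%:E)%E.
Proof.
elim: s => [_|[c f] s IH s0].
  by rewrite big_nil esum1 // => i _; rewrite big_nil.
have c0 : 0 <= c by apply: s0; rewrite inE eqxx.
have {}s0 k : k \in map fst s -> 0 <= k by move=> ks; rewrite s0 // inE ks orbT.
under eq_esum do rewrite big_cons EFinD.
rewrite big_cons EFinD -IH // EFinM -sqsumE -esumZ //=.
apply: esumD => i _; rewrite lee_fin; first by rewrite mulr_ge0 ?exprn_ge0.
rewrite big_seq; apply: sumr_ge0 => -[k g] kg /=.
by rewrite mulr_ge0 ?exprn_ge0 // s0 //; apply/mapP; exists (k, g).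
Qed.

(** Moving the negative coefficients to the other side leaves an inequality
    between sums of nonnegative terms, where extended sums are additive and
    monotone. *)
Lemma sqnorm_form_ge0 (s : seq (R * l2)) :
  (forall i, 0 <= \sum_(k <- s) k.1 * `|k.2 i| ^+ 2) ->
  0 <= \sum_(k <- s) k.1 * sqnorm k.2.
Proof.
pose pos (k : R * l2) := (Num.max k.1 0, k.2).
pose neg (k : R * l2) := (Num.max (- k.1) 0, k.2).
have splitE (q : l2 -> R) : \sum_(k <- s) k.1 * q k.2 =
    \sum_(k <- map pos s) k.1 * q k.2 - \sum_(k <- map neg s) k.1 * q k.2.
  rewrite !big_map -sumrB; apply: eq_bigr => k _ /=.
  rewrite -mulrBl; congr (_ * _).
  by case: (ltrgt0P k.1) => k0; rewrite /Num.max; do ! case: ifP => ?; lra.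
move=> h; rewrite splitE subr_ge0 -lee_fin -!esum_sqnorm.
- apply: le_esum => i _; rewrite lee_fin -subr_ge0.
  by rewrite -(splitE (fun f => `|f i| ^+ 2)).
- by move=> _ /mapP[_ /mapP[k _ ->] ->] /=; rewrite le_max lexx orbT.
- by move=> _ /mapP[_ /mapP[k _ ->] ->] /=; rewrite le_max lexx orbT.
Qed.

Lemma sqnorm_form0 (s : seq (R * l2)) :
  (forall i, \sum_(k <- s) k.1 * `|k.2 i| ^+ 2 = 0) ->
  \sum_(k <- s) k.1 * sqnorm k.2 = 0.
Proof.
move=> h; apply/eqP; rewrite eq_le; apply/andP; split; last first.
  by apply: sqnorm_form_ge0 => i; rewrite h.
rewrite -oppr_ge0 -sumrN.
have := @sqnorm_form_ge0 [seq (- k.1, k.2) | k <- s].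
rewrite big_map; under eq_bigr do rewrite mulNr; apply=> i.
by rewrite big_map; under eq_bigr do rewrite mulNr; rewrite sumrN h oppr0.
Qed.

Lemma sqsum_dom (h : forall i, H i) (C : R) f g :
  (forall i, `|h i| ^+ 2 <= C * (`|f i| ^+ 2 + `|g i| ^+ 2)) ->
  (sqsum h < +oo)%E.
Proof.
move=> hfg; apply: (@le_lt_trans _ _ (`|C| * (sqnorm f + sqnorm g))%:E) => //.
  apply: sqsum_le => s us; rewrite lee_fin.
  apply: (@le_trans _ _ (\sum_(i <- s) `|C| * (`|f i| ^+ 2 + `|g i| ^+ 2))).
    apply: ler_sum => i _; apply: le_trans (hfg i) _.
    by rewrite ler_wpM2r ?ler_norm // addr_ge0 ?exprn_ge0.
  by rewrite -mulr_sumr big_split ler_wpM2l // lerD ?sqnorm_ge.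
exact: ltry.
Qed.

(** A quadratic substitute for the triangle inequality: linear in the squared
    norms, so that it passes to sums.  The difference of the two sides, with
    [`|a| + `|b|] for [`|a + b|], is [t^-1 * (t * `|a| - `|b|) ^+ 2]. *)
Lemma normD_weighted (V : normedModType R) (t : R) (a b : V) : 0 < t ->
  `|a + b| ^+ 2 <= (1 + t) * `|a| ^+ 2 + (1 + t^-1) * `|b| ^+ 2.
Proof.
move=> t0; apply: (@le_trans _ _ ((`|a| + `|b|) ^+ 2)).
  by rewrite ler_pXn2r ?nnegrE ?addr_ge0 ?ler_normD.
rewrite -subr_ge0.
have -> : (1 + t) * `|a| ^+ 2 + (1 + t^-1) * `|b| ^+ 2 - (`|a| + `|b|) ^+ 2
    = t^-1 * (t * `|a| - `|b|) ^+ 2 by field; rewrite gt_eqF.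
by rewrite mulr_ge0 ?sqr_ge0 // invr_ge0 ltW.
Qed.

Lemma sqsum0 : (sqsum (fun i => 0%R : H i) < +oo)%E.
Proof.
rewrite /sqsum esum1 ?ltry // => i _.
by rewrite normr0 expr0n.
Qed.
Definition l2_zero := L2 sqsum0.

Let sqsumN f : (sqsum (fun i => (- f i)%R) < +oo)%E.
Proof.
by rewrite /sqsum; under eq_esum do rewrite normrN; exact: l2_finite.
Qed.
Definition l2_opp f := L2 (sqsumN f).

Let sqsumD f g : (sqsum (fun i => (f i + g i)%R) < +oo)%E.
Proof.
apply: (@sqsum_dom _ 2 f g) => i.
have := normD_weighted (f i) (g i) (@ltr01 R).
by rewrite invr1 -mulrDr.
Qed.
Definition l2_add f g := L2 (sqsumD f g).

Let sqsum_scale (c : R) f : (sqsum (fun i => (c *: f i)%R) < +oo)%E.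
Proof.
apply: (@sqsum_dom _ (c ^+ 2) f l2_zero) => i /=.
by rewrite normrZ exprMn normr0 expr0n addr0 real_normK ?num_real.
Qed.
Definition l2_scale c f := L2 (sqsum_scale c f).

Let l2_addA : associative l2_add.
Proof. by move=> f g h; apply: l2_ext => i /=; rewrite addrA. Qed.
Let l2_addC : commutative l2_add.
Proof. by move=> f g; apply: l2_ext => i /=; rewrite addrC. Qed.
Let l2_add0 : left_id l2_zero l2_add.
Proof. by move=> f; apply: l2_ext => i /=; rewrite add0r. Qed.
Let l2_addN : left_inverse l2_zero l2_opp l2_add.
Proof. by move=> f; apply: l2_ext => i /=; rewrite addNr. Qed.
HB.instance Definition _ :=
  GRing.isZmodule.Build l2 l2_addA l2_addC l2_add0 l2_addN.

Let l2_scaleA a b f : l2_scale a (l2_scale b f) = l2_scale (a * b) f.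
Proof. by apply: l2_ext => i /=; rewrite scalerA. Qed.
Let l2_scale1 : left_id 1 l2_scale.
Proof. by move=> f; apply: l2_ext => i /=; rewrite scale1r. Qed.
Let l2_scaleDr : right_distributive l2_scale +%R.
Proof. by move=> a f g; apply: l2_ext => i /=; rewrite scalerDr. Qed.
Let l2_scaleDl f : {morph l2_scale^~ f : a b / a + b}.
Proof. by move=> a b; apply: l2_ext => i /=; rewrite scalerDl. Qed.
HB.instance Definition _ := GRing.Zmodule_isLmodule.Build R l2
  l2_scaleA l2_scale1 l2_scaleDr l2_scaleDl.

Lemma l2B f g i : (f - g) i = f i - g i. Proof. by []. Qed.

Definition l2_norm f : R := Num.sqrt (sqnorm f).

Lemma l2_norm_sqr f : l2_norm f ^+ 2 = sqnorm f.
Proof. by rewrite sqr_sqrtr ?sqnorm_ge0. Qed.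

Lemma sqnormZ c f : sqnorm (c *: f) = c ^+ 2 * sqnorm f.
Proof.
have := @sqnorm_form0 [:: (1, c *: f); (- c ^+ 2, f)].
rewrite !big_cons big_nil /= addr0 mul1r mulNr => h.
apply/subr0_eq; apply: h => i; rewrite !big_cons big_nil /=.
by rewrite normrZ exprMn real_normK ?num_real //; ring.
Qed.

Lemma l2_normZ (c : R) f : l2_norm (c *: f) = `|c| * l2_norm f.
Proof. by rewrite /l2_norm sqnormZ sqrtrM ?sqr_ge0 // sqrtr_sqr. Qed.

Lemma l2_coord_le f i : `|f i| <= l2_norm f.
Proof.
rewrite -(@ler_pXn2r _ 2) ?nnegrE ?sqrtr_ge0 // l2_norm_sqr.
by have := @sqnorm_ge f [:: i] isT; rewrite big_seq1.
Qed.

Lemma l2_norm_eq0 f : l2_norm f = 0 -> f = 0.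
Proof.
move=> f0; apply: l2_ext => i; apply/eqP.
by rewrite -normr_le0 -f0 l2_coord_le.
Qed.

Lemma sqnormD_weighted t f g : 0 < t ->
  sqnorm (f + g) <= (1 + t) * sqnorm f + (1 + t^-1) * sqnorm g.
Proof.
move=> t0.
have := @sqnorm_form_ge0 [:: (1 + t, f); (1 + t^-1, g); (-1, f + g)].
rewrite !big_cons big_nil /= addr0 mulN1r addrA subr_ge0; apply=> i.
rewrite !big_cons big_nil /= addr0 mulN1r addrA subr_ge0.
exact: normD_weighted.
Qed.

(** With [t = l2_norm g / l2_norm f] the weighted bound is exactly
    [(l2_norm f + l2_norm g) ^+ 2]. *)
Lemma l2_normD f g : l2_norm (f + g) <= l2_norm f + l2_norm g.
Proof.
have [f0|fn0] := eqVneq (l2_norm f) 0.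
  by rewrite (l2_norm_eq0 f0) add0r /= lerDr sqrtr_ge0.
have [g0|gn0] := eqVneq (l2_norm g) 0.
  by rewrite (l2_norm_eq0 g0) addr0 /= lerDl sqrtr_ge0.
have f0 : 0 < l2_norm f by rewrite lt_def fn0 sqrtr_ge0.
have g0 : 0 < l2_norm g by rewrite lt_def gn0 sqrtr_ge0.
rewrite -(@ler_pXn2r _ 2) ?nnegrE ?addr_ge0 ?sqrtr_ge0 // l2_norm_sqr.
apply: (le_trans (sqnormD_weighted f g (divr_gt0 g0 f0))).
rewrite -!l2_norm_sqr le_eqVlt; apply/orP; left; apply/eqP.
by field; rewrite fn0.
Qed.

HB.instance Definition _ :=
  Lmodule_isNormed.Build R l2 l2_normD l2_normZ l2_norm_eq0.

Lemma l2_norm2E f : `|f| ^+ 2 = sqnorm f. Proof. exact: l2_norm_sqr. Qed.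

(** Polarization: no signed infinite sum has to be given a meaning. *)
Definition l2_dot f g : R := (sqnorm (f + g) - sqnorm f - sqnorm g) / 2.

Let l2_dotC f g : l2_dot f g = l2_dot g f.
Proof. by rewrite /l2_dot [f + g]addrC addrAC. Qed.

(** Cleared of the denominator, this is a linear relation between seven squared
    norms, true in each coordinate. *)
Let l2_dot_linear c f g h : l2_dot (c *: f + g) h = c * l2_dot f h + l2_dot g h.
Proof.
rewrite /l2_dot; apply/subr0_eq.
have := @sqnorm_form0 [:: (1, c *: f + g + h); (-1, c *: f + g); (- c, f + h);
  (c, f); (c, h); (-1, g + h); (1, g)].
rewrite !big_cons big_nil /= => E.
rewrite -[RHS](mul0r 2^-1) -{}E; first by field.
move=> i; rewrite !big_cons big_nil /= !hilbert_normD !hilbert_dotDl.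
by rewrite !hilbert_dotZl; ring.
Qed.

Let l2_dot_additivel h : zmod_morphism (l2_dot^~ h).
Proof.
by move=> f g /=; rewrite -scaleN1r addrC l2_dot_linear mulN1r addrC.
Qed.
Let l2_dot_additiver f : zmod_morphism (l2_dot f).
Proof. by move=> g h; rewrite !(l2_dotC f) l2_dot_additivel. Qed.
Let l2_dot_scalel h : scalable_for *%R (l2_dot^~ h).
Proof.
move=> c f /=; have := l2_dot_linear c f 0 h; rewrite addr0 => ->.
suff -> : l2_dot 0 h = 0 by rewrite addr0.
by have /= := l2_dot_additivel h 0 0; rewrite !subrr.
Qed.
Let l2_dot_scaler f : scalable_for (idfun \; *%R) (l2_dot f).
Proof. by move=> c g; rewrite !(l2_dotC f) l2_dot_scalel. Qed.
HB.instance Definition _ := @isBilinear.Build R l2 l2 R _ _ l2_dot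
  l2_dot_additivel l2_dot_additiver l2_dot_scalel l2_dot_scaler.

Let l2_dot_herm f g : l2_dot f g = (-1) ^+ false * idfun (l2_dot g f).
Proof. by rewrite expr0 mul1r /= l2_dotC. Qed.
HB.instance Definition _ :=
  @isHermitianSesquilinear.Build R l2 false idfun l2_dot l2_dot_herm.

Lemma l2_dotxx f : `|f| ^+ 2 = l2_dot f f.
Proof.
rewrite /l2_dot -[f + f]/(f *+ 2) -scaler_nat sqnormZ l2_norm2E.
by field.
Qed.

Let l2_dot_gt0 f : f != 0 -> 0 < l2_dot f f.
Proof. by move=> f0; rewrite -l2_dotxx exprn_gt0 ?normr_gt0. Qed.
HB.instance Definition _ := @isDotProduct.Build R l2 l2_dot l2_dot_gt0.

(** The limit [g] is taken coordinatewise.  If the filter charges the ball of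
    radius [e] around [f], passing to the limit in finite partial sums gives
    [sqsum (g - f) <= e ^+ 2]; this puts [g] in the space and bounds its
    distance to [f]. *)
Let l2_complete (F : set_system l2) : ProperFilter F -> cauchy F -> cvg F.
Proof.
move=> FF Fc; have Fex : cauchy_ex F by exact/cauchyP.
have coord_cvg i : cvg ((fun f : l2 => f i : H i) @ F).
  apply/cauchy_cvgP; apply: cauchy_exP => e e0.
  have [f Ff] := Fex e e0; exists (f i).
  rewrite /fmap /=; apply: filterS Ff => g; rewrite /= -!ball_normE /=.
  by apply: le_lt_trans; exact: (l2_coord_le (f - g) i).
pose g i : H i := lim ((fun f : l2 => f i : H i) @ F).
have near_g f e : 0 < e -> F (ball f e) ->
    (sqsum (fun i => (g i - f i)%R) <= (e ^+ 2)%:E)%E.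
  move=> e0 Ff; apply: sqsum_le => s us; rewrite lee_fin.
  have cvgs : \sum_(i <- s) `|h i - f i| ^+ 2 @[h --> F] -->
      \sum_(i <- s) `|g i - f i| ^+ 2.
    apply: cvg_big => [|i _]; first exact: add_continuous.
    apply: (@cvg_comp _ _ _ _ (fun x => x ^+ 2)).
      apply: cvg_norm; apply: cvgB; [exact: coord_cvg|exact: cvg_cst].
    exact: exprn_continuous.
  apply: (cvgr_to_le cvgs).
  change (F [set h : l2 | \sum_(i <- s) `|h i - f i| ^+ 2 <= e ^+ 2]).
  apply: filterS Ff => h.
  rewrite -ball_normE /= => fh; apply: (@le_trans _ _ (sqnorm (h - f))).
    exact: (sqnorm_ge (h - f) us).
  rewrite -l2_norm2E ler_pXn2r ?nnegrE //; last exact: ltW.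
  by rewrite distrC ltW.
(* Any ball charged by the filter will do to see that [g] is square-summable. *)
have [f0 Ff0] := Fex 1 ltr01.
have gf0 := le_lt_trans (near_g f0 1 ltr01 Ff0) (ltry _).
pose G : l2 := L2 gf0 + f0.
have GE i : G i = g i by rewrite /= subrK.
apply/cvg_ex; exists G; apply/cvgrPdist_le => e e0.
have [f Ff] := Fex (e / 2) (divr_gt0 e0 (ltr0n _ 2)).
have Gf : `|G - f| <= e / 2.
  rewrite -(@ler_pXn2r _ 2) ?nnegrE ?divr_ge0 // ?(ltW e0) //.
  rewrite l2_norm2E -lee_fin -sqsumE.
  rewrite (_ : sqsum _ = sqsum (fun i => (g i - f i)%R)); last first.
    by apply: eq_esum => i _; rewrite l2B GE.
  by apply: near_g => //; rewrite divr_gt0.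
apply: filterS Ff => h; rewrite -ball_normE /= => fh.
rewrite -(subrKA f) (le_trans (ler_normD _ _)) // [leRHS]splitr lerD //.
exact: ltW.
Qed.
HB.instance Definition _ := Uniform_isComplete.Build l2 l2_complete.

Definition l2_hilbert : hilbertType R :=
  @HilbertType R l2 (l2_dot : {dot l2 for idfun}) l2_dotxx.

End SquareSummable.

Lemma sqsum_supported (R : realType) (I : choiceType) (H : I -> hilbertType R)
    (s : seq I) (f : forall i, H i) : uniq s ->
  (forall i, i \notin s -> f i = 0) ->
  (sqsum f <= (\sum_(i <- s) `|f i| ^+ 2)%:E)%E.
Proof.
move=> us fs; apply: sqsum_le => u uu; rewrite lee_fin.
rewrite (bigID (fun i => i \in s)) /= [X in _ + X]big1 ?addr0; last first.
  by move=> i /fs ->; rewrite normr0 expr0n.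
rewrite [leRHS](bigID (fun i => i \in u)) /=.
rewrite -!(big_filter _ (fun i => i \in _)).
rewrite (perm_big [seq i <- s | i \in u]) ?lerDl ?sumr_ge0 //.
by apply: uniq_perm => [||i]; rewrite ?filter_uniq // !mem_filter andbC.
Qed.

(** * Coarse maps *)
Section CoarseMaps.
Context (R : realType) (Z : Type) (d : Z -> Z -> R).
Hypothesis d_ge0 : forall x y, 0 <= d x y.

(** Coarse embeddings without control functions, whose limits at infinity are
    replaced by the two boundedness conditions. *)
Definition coarse_map (V : normedModType R) (F : Z -> V) : Prop :=
  (forall r, exists s, forall x y, d x y <= r -> `|F x - F y| <= s) /\
  (forall s, exists r, forall x y, `|F x - F y| <= s -> d x y <= r).

Lemma coarsely_embeddable_map : coarsely_embeddable d ->
  exists (H : hilbertType R) (F : Z -> H), coarse_map F.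
Proof.
move=> [H [dot [dotE [F [rho1 [rho2 [homo1 homo2 lim1 lim2 rhoF]]]]]]].
exists (HilbertType dotE), F; split=> [r|s].
  exists (rho2 (Num.max r 0)) => x y xyr.
  have /andP[_] := rhoF x y; move/le_trans; apply.
  by rewrite homo2 ?nnegrE ?le_max ?lexx ?d_ge0 ?orbT // xyr.
have /cvgryPgt/(_ s)[M [_ rho1M]] := lim1.
exists M => x y xys; rewrite leNgt; apply/negP => /rho1M/= s_lt.
have /andP[le1 _] := rhoF x y.
by have := lt_le_trans s_lt (le_trans le1 xys); rewrite ltxx.
Qed.

(** The control functions are the infimum of the image distances over pairs at
    distance at least [t] and the supremum over pairs at distance at most [t].
    Adding the half-lines from [t] to these sets makes them nonempty and forces
    the second function to infinity even when [Z] is bounded; the first one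
    tends to infinity because small image distances bound [d]. *)
Lemma coarse_map_embeddable (H : hilbertType R) (F : Z -> H) :
  coarse_map F -> coarsely_embeddable d.
Proof.
move=> [upF loF].
exists H, (hilbert_dot H); split; first exact: hilbert_norm.
pose above t := [set u | t <= u] `|`
  [set u | exists x y, t <= d x y /\ u = `|F x - F y|].
pose below t := [set u | u <= t] `|`
  [set u | exists x y, d x y <= t /\ u = `|F x - F y|].
have above_inf t : has_inf (above t).
  split; first by exists t; left; rewrite /= lexx.
  exists (Num.min t 0) => u [/= tu|[x [y [_ ->]]]].
    by rewrite ge_min tu.
  by rewrite ge_min normr_ge0 orbT.
have below_sup t : has_sup (below t).
  split; first by exists t; left; rewrite /= lexx.
  have [s sP] := upF t.
  exists (Num.max t s) => u [/= tu|[x [y [xyt ->]]]].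
    by rewrite le_max tu.
  by rewrite le_max sP ?orbT.
have le_rho2 t : t <= sup (below t).
  by apply: sup_upper_bound => //; left; rewrite /= lexx.
exists F, (inf \o above), (sup \o below); split.
- move=> s t _ _ st /=; apply: lb_le_inf; first by case: (above_inf t).
  move=> u tu; apply: inf_lbound; first by case: (above_inf s).
  case: tu => [/= tu|[x [y [txy ->]]]]; first by left; exact: le_trans tu.
  by right; exists x, y; split=> //; exact: le_trans txy.
- move=> s t _ _ st /=; apply: ge_sup; first by case: (below_sup s).
  move=> u su; apply: sup_upper_bound => //.
  case: su => [/= su|[x [y [txy ->]]]]; first by left; exact: le_trans st.
  by right; exists x, y; split=> //; exact: le_trans st.
- apply/cvgryPge => A; have [r rP] := loF A.
  exists (Num.max r A); split; first exact: num_real.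
  move=> t /=; rewrite gt_max => /andP[rt At].
  apply: lb_le_inf; first by case: (above_inf t).
  move=> u [/= tu|[x [y [txy ->]]]]; first exact: le_trans (ltW At) tu.
  rewrite leNgt; apply/negP => /ltW/rP xyr.
  by have := lt_le_trans rt (le_trans txy xyr); rewrite ltxx.
- apply/cvgryPge => A; exists A; split; first exact: num_real.
  by move=> t At /=; exact: le_trans (ltW At) (le_rho2 t).
- move=> x y /=; apply/andP; split.
    apply: inf_lbound; first by case: (above_inf (d x y)).
    by right; exists x, y.
  by apply: sup_upper_bound => //; right; exists x, y.
Qed.

End CoarseMaps.

(** * Gates of sheets *)
Section Gate.
Context (A : eqType) (T : Type) (point : A -> T) (e : T).

(** The sheets below the sheet [w] hang off it at the points named by the letter
    that follows [w] in their word; all other sheets are reached through its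
    base point [e].  So [gate w v] is the point of the sheet [w] nearest to the
    sheet [v]. *)
Fixpoint gate (w v : seq A) : T :=
  match w, v with
  | [::], a :: _ => point a
  | b :: w', a :: v' => if a == b then gate w' v' else e
  | _, [::] => e
  end.

Lemma gate_rcons w v a :
  gate w (rcons v a) = if v == w then point a else gate w v.
Proof.
elim: w v => [|b w IH] [|c v] //=.
  by case: w {IH} => [|? ?]; case: ifP.
by rewrite IH eqseq_cons; case: (c == b).
Qed.

Lemma gate_refl w : gate w w = e.
Proof. by elim: w => //= a w ->; rewrite eqxx. Qed.

Lemma gate_out w v : ~~ prefix w v -> gate w v = e.
Proof.
elim: w v => [|b w IH] [|a v] //=.
by rewrite eq_sym; case: eqP => //= _ /IH.
Qed.

Lemma gate_nil w : gate w [::] = e.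
Proof. by case: w. Qed.

End Gate.

Lemma prefix_rconsE (A : eqType) (v w : seq A) a :
  prefix v (rcons w a) = (v == rcons w a) || prefix v w.
Proof.
elim: w v => [|b w IH] [|c v] //=.
  by case: v => [|d v]; rewrite eqseq_cons ?andbF ?orbF.
by rewrite IH eqseq_cons; case: (c == b).
Qed.

(** * The path metric *)
Section Tree.
Context (R : realType) (X Y : metricType R) (NX : net X) (NY : net Y).
Context (epsX : NX) (epsY : NY).

Local Notation letter := (letter epsX epsY).
Local Notation WX := (WX epsX epsY).
Local Notation WY := (WY epsX epsY).
Local Notation pre := (pre_product epsX epsY).
Local Notation fp := (free_product epsX epsY).
Local Notation emptyX := (@emptyX R X Y NX NY epsX epsY).
Local Notation emptyY := (@emptyY R X Y NX NY epsX epsY).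
Local Notation eX := (net_base NX).
Local Notation eY := (net_base NY).

Local Notation glue := (@Defs.glue R X Y NX NY epsX epsY).

HB.instance Definition _ := gen_eqMixin letter.
HB.instance Definition _ := gen_choiceMixin letter.

Implicit Types (p q : pre) (P Q : fp) (v : seq letter).

Lemma dstar_chain P Q l : chain P Q l -> dstar P Q <= l.
Proof. by move=> c; apply: inf_lbound => //; case: (dstar_has_inf P Q). Qed.

Lemma dstar_hop P Q l : hop P Q l -> dstar P Q <= l.
Proof.
by move=> h; rewrite -[l]addr0; apply/dstar_chain/(ChainCons h)/ChainNil.
Qed.

Lemma chain_cat P Q T l m : chain P Q l -> chain Q T m -> chain P T (l + m).
Proof.
move=> c; elim: c T m => [{}P T m|{}P P1 Q1 l1 l2 h _ IH T m /IH c].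
  by rewrite add0r.
by rewrite -addrA; exact: ChainCons h c.
Qed.

Lemma chain_rev P Q l : chain P Q l -> chain Q P l.
Proof.
elim=> [T|P1 Q1 T l1 l2 /hop_sym h _ c]; first exact: ChainNil.
rewrite addrC -[l1]addr0; apply: chain_cat c _.
exact: ChainCons h (ChainNil _).
Qed.

Lemma dstar_sym P Q : dstar P Q = dstar Q P.
Proof.
suff le P' Q' : dstar P' Q' <= dstar Q' P' by apply/eqP; rewrite eq_le !le.
apply: lb_le_inf; first by case: (dstar_has_inf Q' P').
by move=> l /= /chain_rev; exact: dstar_chain.
Qed.

Lemma dstar_triangle Q P T : dstar P T <= dstar P Q + dstar Q T.
Proof.
rewrite -lerBlDr; apply: lb_le_inf; first by case: (dstar_has_inf P Q).
move=> l /= PQ; rewrite lerBlDr addrC -lerBlDr.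
apply: lb_le_inf; first by case: (dstar_has_inf Q T).
by move=> m /= QT; rewrite lerBlDr addrC; exact/dstar_chain/(chain_cat PQ).
Qed.

Lemma cls_glue p q : glue p q -> cls p = cls q.
Proof. by move=> g; apply/eqmodP/asboolP; exact: rst_step. Qed.

Definition pseudometric (e : pre -> pre -> R) :=
  [/\ forall p, e p p = 0, forall p q, e p q = e q p
    & forall p q r, e p r <= e p q + e q r].

Definition cell_bounded (e : pre -> pre -> R) :=
  [/\ forall w x x', e (SheetX w x) (SheetX w x') <= mdist x x',
      forall w y y', e (SheetY w y) (SheetY w y') <= mdist y y',
      forall w x0 s t, e (EdgeX w x0 s) (EdgeX w x0 t) <= `|s%:num - t%:num|,
      forall w y0 s t, e (EdgeY w y0 s) (EdgeY w y0 t) <= `|s%:num - t%:num|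
    & forall s t, e (EdgeBase _ _ s) (EdgeBase _ _ t) <= `|s%:num - t%:num|].

(** Along a chain the triangle inequality adds up the bounds of the cells, and
    vanishing on glued points is what makes [e] descend to the quotient. *)
Lemma dstar_largest (e : pre -> pre -> R) :
  pseudometric e -> (forall p q, glue p q -> e p q = 0) -> cell_bounded e ->
  forall p q, e p q <= dstar (cls p) (cls q).
Proof.
move=> [e0 eC eT] eG [cX cY cEX cEY cE].
have e_ge0 p q : 0 <= e p q.
  by have := eT p q p; rewrite e0 (eC q p) -mulr2n -mulr_natl pmulr_rge0.
have eqv p q : clos_refl_sym_trans _ glue p q -> e p q = 0.
  elim=> [a b /eG //|a|a b _|a b c _ ab _ bc]; [exact: e0|by rewrite eC|].
  by apply/eqP; rewrite eq_le e_ge0 andbT (le_trans (eT a b c)) // ab bc addr0.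
have eK p : e p (repr (cls p)) = 0.
  apply: eqv; have /eqmodP/asboolP := reprK (cls p).
  exact: rst_sym.
have eK' p : e (repr (cls p)) p = 0 by rewrite eC eK.
have le_cls p q c : e p q <= c -> e (repr (cls p)) (repr (cls q)) <= c.
  apply: le_trans; apply: le_trans (eT _ p _) _; rewrite eK' add0r.
  by apply: le_trans (eT _ q _) _; rewrite eK addr0.
have le_hop P Q l : hop P Q l -> e (repr P) (repr Q) <= l.
  by case=> *; apply: le_cls.
have le_chain P Q l : chain P Q l -> e (repr P) (repr Q) <= l.
  elim=> [T|P1 Q1 T l1 l2 h _ IH]; first by rewrite e0.
  exact: le_trans (eT _ (repr Q1) _) (lerD (le_hop _ _ _ h) IH).
move=> p q; apply: lb_le_inf; first by case: (dstar_has_inf (cls p) (cls q)).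
move=> l /le_chain; apply: le_trans.
apply: le_trans (eT _ (repr (cls p)) _) _; rewrite eK add0r.
by apply: le_trans (eT _ (repr (cls q)) _) _; rewrite eK' addr0.
Qed.

(** * Coordinates on sheets and edges *)
Definition sheet := (WX + WY)%type.

(** An edge other than the base edge carries the word of the sheet at its far
    end, so nonempty words also name these edges. *)
Definition word p : seq letter :=
  match p with
  | SheetX w _ => val w
  | SheetY w _ => val w
  | EdgeX w x0 _ => rcons (val w) (inl x0)
  | EdgeY w y0 _ => rcons (val w) (inr y0)
  | EdgeBase _ => [::]
  end.

(** The position of a point on the last edge of its route from the root; a sheet
    lies wholly beyond that edge. *)
Definition height p : R :=
  match p with
  | EdgeX _ _ t => t%:num
  | EdgeY _ _ t => t%:num
  | _ => 1
  end.

(** The fraction of the edge [v] covered by the route from the root to [p].  The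
    empty word names no edge: its coordinate is constantly 1, and the base edge
    has no coordinate. *)
Definition crossing v p : R :=
  if v == word p then height p else (prefix v (word p))%:R.

Definition pointX (l : letter) : X :=
  if l is inl x0 then net_map (sval x0) else eX.
Definition pointY (l : letter) : Y :=
  if l is inr y0 then net_map (sval y0) else eY.

Definition projX (w : WX) p : X :=
  if p is SheetX w' x then
    if val w' == val w then x else gate pointX eX (val w) (val w')
  else gate pointX eX (val w) (word p).

Definition projY (w : WY) p : Y :=
  if p is SheetY w' y then
    if val w' == val w then y else gate pointY eY (val w) (val w')
  else gate pointY eY (val w) (word p).

Lemma crossing_prefix v p :
  height p = 1 -> crossing v p = (prefix v (word p))%:R.
Proof.
by rewrite /crossing => ->; case: eqVneq => // ->; rewrite prefix_refl.
Qed.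

Lemma prefix_rcons_self (w : seq letter) a : prefix (rcons w a) w = false.
Proof.
by apply/negP => /size_prefix; rewrite size_rcons ltnn.
Qed.

(** Only the gluing at the near end of an edge needs an argument: the word gains
    a letter there, and the only coordinate that this could change is that of
    the new edge, which is still 0. *)
Lemma crossing_glue v p q : glue p q -> crossing v p = crossing v q.
Proof.
by case=> [||w a|w a|w a|w a] //=; rewrite crossing_prefix // /crossing /=
     prefix_rconsE; case: eqVneq => [->|_]; rewrite ?prefix_rcons_self.
Qed.

(** Passing from a sheet [w'] to an edge leaving it appends a letter to the
    word, and by [gate_rcons] this moves the gate only on the sheet [w'] itself,
    where the new gate is the point from which the edge leaves. *)
Lemma projX_glue w p q : glue p q -> projX w p = projX w q.
Proof.
case=> [||w' x0|w' x0|w' y0|w' y0] //=.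
- by rewrite gate_nil if_same.
- by rewrite gate_rcons; case: eqVneq.
- rewrite gate_rcons; case: eqVneq => // ->.
  by rewrite gate_refl.
- by case: eqVneq => // <-; rewrite gate_refl.
Qed.

Lemma projY_glue w p q : glue p q -> projY w p = projY w q.
Proof.
case=> [||w' x0|w' x0|w' y0|w' y0] //=.
- by rewrite gate_nil if_same.
- rewrite gate_rcons; case: eqVneq => // ->.
  by rewrite gate_refl.
- by case: eqVneq => // <-; rewrite gate_refl.
- by rewrite gate_rcons; case: eqVneq.
Qed.

Definition sheet_dist (s : sheet) p q : R :=
  match s with
  | inl w => mdist (projX w p) (projX w q)
  | inr w => mdist (projY w p) (projY w q)
  end.

Definition edge_dist v p q : R := `|crossing v p - crossing v q|.

Lemma sheet_dist_pseudo s : pseudometric (sheet_dist s).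
Proof.
case: s => w; split=> * /=.
- exact: mdistxx.
- exact: metric_sym.
- exact: metric_triangle.
- exact: mdistxx.
- exact: metric_sym.
- exact: metric_triangle.
Qed.

Lemma edge_dist_pseudo v : pseudometric (edge_dist v).
Proof.
split=> *; rewrite /edge_dist; [by rewrite subrr normr0|exact: distrC|].
exact: ler_distD.
Qed.

Lemma sheet_dist_ge0 s p q : 0 <= sheet_dist s p q.
Proof. by case: s => w /=; exact: mdist_ge0. Qed.

Lemma sheet_dist_le_dstar s p q : sheet_dist s p q <= dstar (cls p) (cls q).
Proof.
apply: (dstar_largest (sheet_dist_pseudo s)) => [{}p {}q pq|].
  case: s => w /=; first by rewrite (projX_glue w pq) mdistxx.
  by rewrite (projY_glue w pq) mdistxx.
case: s => w; split=> *; rewrite /= ?mdistxx ?mdist_ge0 ?normr_ge0 //.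
  by case: ifP => _ //; rewrite mdistxx mdist_ge0.
by case: ifP => _ //; rewrite mdistxx mdist_ge0.
Qed.

(** A cell lies in at most one edge, so within a cell at most one term of the
    sum varies; this is where [E] must have no repetition. *)
Lemma crossings_le_dstar (E : seq (seq letter)) p q : uniq E ->
  \sum_(v <- E) edge_dist v p q <= dstar (cls p) (cls q).
Proof.
move=> uE; apply: (@dstar_largest (fun p q => \sum_(v <- E) edge_dist v p q)).
- split=> [{}p|{}p {}q|{}p {}q r].
  + by rewrite big1 // => v _; case: (edge_dist_pseudo v).
  + by apply: eq_bigr => v _; case: (edge_dist_pseudo v).
  + rewrite -big_split /=; apply: ler_sum => v _.
    by have [_ _] := edge_dist_pseudo v; exact.
- move=> {}p {}q pq; rewrite big1 // => v _.
  by rewrite /edge_dist (crossing_glue v pq) subrr normr0.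
have edge_sum (a b : pre) (c : R) : 0 <= c -> word a = word b ->
    `|height a - height b| <= c -> \sum_(v <- E) edge_dist v a b <= c.
  move=> c0 ab hc.
  have off v : v != word a -> edge_dist v a b = 0.
    move=> va; rewrite /edge_dist /crossing -ab (negPf va).
    by rewrite subrr normr0.
  have [aE|aE] := boolP (word a \in E); last first.
    rewrite big1_seq // => v /andP[_ vE].
    by rewrite off //; apply: contraNneq aE => <-.
  rewrite (bigD1_seq (word a)) //= big1 ?addr0 => [|v /off //].
  by rewrite /edge_dist /crossing -ab eqxx.
by split=> *; apply: edge_sum; rewrite //= ?subrr ?normr0 ?mdist_ge0.
Qed.

(** * Routes *)
Definition is_sheet p : bool :=
  match p with SheetX _ _ => true | SheetY _ _ => true | _ => false end.

(** [S] and [E] list the sheets and the edges on the way from [p] to [q].  A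
    route with [n] crossed edges visits at most [n + 1] sheets, or [n + 2] if it
    also takes the base edge, which has no coordinate and accounts for the last
    [1] in the length. *)
Definition route p q (S : seq sheet) (E : seq (seq letter)) : Prop :=
  [/\ uniq E, forall v, v \in E -> edge_dist v p q = 1,
      (size S <= (size E).+2)%N,
      (forall s, s \notin S -> sheet_dist s p q = 0) /\
      (forall v, v \notin E -> edge_dist v p q = 0)
    & dstar (cls p) (cls q) <=
        \sum_(s <- S) sheet_dist s p q + (size E)%:R + 1].

Lemma sheet_distC s p q : sheet_dist s p q = sheet_dist s q p.
Proof. by case: (sheet_dist_pseudo s). Qed.

Lemma edge_distC v p q : edge_dist v p q = edge_dist v q p.
Proof. exact: distrC. Qed.

Lemma route_sym p q S E : route p q S E -> route q p S E.
Proof.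
move=> [uE E1 SE [S0 E0] le]; split=> //.
- by move=> v /E1; rewrite edge_distC.
- by split=> [s /S0|v /E0]; rewrite (sheet_distC, edge_distC).
- rewrite dstar_sym; apply: le_trans le _.
  by under eq_bigr do rewrite sheet_distC.
Qed.

(** The point [p] lies on the sheet [s] beyond the edge [word p], whose near end
    is [p'], and [q] is on the near side of that edge.  The edge cannot already
    be in [E], since [p'] and [q] agree there. *)
Lemma route_extend s p p' q S E :
  (forall s', s' != s -> sheet_dist s' p q = sheet_dist s' p' q) ->
  (forall v, v != word p -> edge_dist v p q = edge_dist v p' q) ->
  edge_dist (word p) p q = 1 -> edge_dist (word p) p' q = 0 ->
  sheet_dist s p' q = 0 ->
  dstar (cls p) (cls p') <= sheet_dist s p q + 1 ->
  route p' q S E -> route p q (s :: S) (word p :: E).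
Proof.
move=> sS vE p1 p0 s0 pp' [uE E1 SE [S0 E0] le].
have pE : word p \notin E.
  by apply/negP => /E1/eqP; rewrite p0 eq_sym oner_eq0.
split=> //=.
- by rewrite pE.
- move=> v; rewrite inE => /orP[/eqP -> //|vin].
  by rewrite vE ?E1 //; apply: contraNneq pE => <-.
- split=> [s'|v]; rewrite inE negb_or => /andP[ne nin].
    by rewrite sS ?S0.
  by rewrite vE ?E0.
rewrite big_cons -natr1; apply: le_trans (dstar_triangle (cls p') _ _) _.
have : \sum_(i <- S) sheet_dist i p' q <= \sum_(i <- S) sheet_dist i p q.
  apply: ler_sum => s' _; have [->|/sS -> //] := eqVneq s' s.
  by rewrite s0 sheet_dist_ge0.
by move: le pp'; lra.
Qed.

Lemma projX_out w q : ~~ prefix (val w) (word q) -> projX w q = eX.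
Proof.
case: q => [w' x|w' y|w' x0 t|w' y0 t|t] /= h; rewrite ?gate_out //.
by case: eqP h => // ->; rewrite prefix_refl.
Qed.

Lemma projY_out w q : ~~ prefix (val w) (word q) -> projY w q = eY.
Proof.
case: q => [w' x|w' y|w' x0 t|w' y0 t|t] /= h; rewrite ?gate_out //.
by case: eqP h => // ->; rewrite prefix_refl.
Qed.

Lemma crossing_out v q : ~~ prefix v (word q) -> crossing v q = 0.
Proof.
move=> h; rewrite /crossing (negPf h); case: eqP h => // ->.
by rewrite prefix_refl.
Qed.

Lemma dstar_edgeX (w : WX) x0 :
  dstar (cls (SheetY (extendX w x0) eY))
    (cls (SheetX w (net_map (sval x0)))) <= 1.
Proof.
rewrite (cls_glue (GlueX0 _ _)) (cls_glue (GlueX1 _ _)).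
apply: le_trans (dstar_hop (HopEdgeX _ _ _ _)) _.
by rewrite /= subr0 normr1.
Qed.

Lemma dstar_edgeY (w : WY) y0 :
  dstar (cls (SheetX (extendY w y0) eX))
    (cls (SheetY w (net_map (sval y0)))) <= 1.
Proof.
rewrite (cls_glue (GlueY0 _ _)) (cls_glue (GlueY1 _ _)).
apply: le_trans (dstar_hop (HopEdgeY _ _ _ _)) _.
by rewrite /= subr0 normr1.
Qed.

Lemma dstar_edge_base :
  dstar (cls (SheetX emptyX eX)) (cls (SheetY emptyY eY)) <= 1.
Proof.
rewrite (cls_glue (GlueBaseX _ _)) (cls_glue (GlueBaseY _ _)).
apply: le_trans (dstar_hop (HopEdgeBase _ _ _ _)) _.
by rewrite /= sub0r normrN normr1.
Qed.

Lemma WX_extendY (w : WX) : val w != [::] -> exists w' y0, w = extendY w' y0.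
Proof.
case: w => w /=; case/lastP: w => // s [x0|y0] wP _.
  by exfalso; move: wP; rewrite /ends_in_X map_rcons last_rcons andbF.
have sP : Defs.alternating s && ~~ ends_in_Y s.
  by case/andP: wP; rewrite rcons_normal.
by exists (exist _ s sP), y0; exact/val_inj.
Qed.

Lemma WY_extendX (w : WY) : val w != [::] -> exists w' x0, w = extendX w' x0.
Proof.
case: w => w /=; case/lastP: w => // s [x0|y0] wP _; last first.
  by exfalso; move: wP; rewrite /ends_in_Y map_rcons last_rcons andbF.
have sP : Defs.alternating s && ~~ ends_in_X s.
  by case/andP: wP; rewrite rcons_normal.
by exists (exist _ s sP), x0; exact/val_inj.
Qed.

Lemma height_sheet p : is_sheet p -> height p = 1.
Proof. by case: p. Qed.

(** [p'] is the point at the near end of the edge leading to the sheet of [p].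
    Points whose word does not extend that of [p] are separated from [p] by this
    edge, so they see the sheet of [p] at its base point. *)
Lemma sheet_parent p : is_sheet p -> word p != [::] ->
  exists p', [/\ is_sheet p', (size (word p') < size (word p))%N
    & forall q S E, ~~ prefix (word p) (word q) -> route p' q S E ->
      exists s, route p q (s :: S) (word p :: E)].
Proof.
have edge_cond (a : letter) (r p' q : pre) :
    is_sheet r -> is_sheet p' -> word r = rcons (word p') a ->
    ~~ prefix (word r) (word q) ->
    [/\ forall v, v != word r -> edge_dist v r q = edge_dist v p' q,
      edge_dist (word r) r q = 1 & edge_dist (word r) p' q = 0].
  move=> /height_sheet hp /height_sheet hp' pa pq; split=> [v vp||].
  - rewrite /edge_dist crossing_prefix // [crossing v p']crossing_prefix //.
    by rewrite pa prefix_rconsE -pa (negPf vp).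
  - rewrite /edge_dist crossing_prefix // (crossing_out pq).
    by rewrite prefix_refl subr0 normr1.
  - rewrite /edge_dist crossing_prefix // (crossing_out pq) pa.
    by rewrite prefix_rcons_self subrr normr0.
case: p => [w x|w y|//|//|//] _ /= w0.
- have [w' [y0 wE]] := WX_extendY w0; rewrite {}wE {w w0}.
  exists (SheetY w' (net_map (sval y0))).
  split=> //=; first by rewrite size_rcons.
  move=> q S E pq r; exists (inl (extendY w' y0)).
  have [h1 h2 h3] := edge_cond (inr y0) (SheetX (extendY w' y0) x)
    (SheetY w' (net_map (sval y0))) q isT isT erefl pq.
  have px : projX (extendY w' y0) (SheetY w' (net_map (sval y0))) = eX.
    by rewrite (projX_glue _ (GlueY0 _ _)) /= gate_refl.
  apply: route_extend h1 h2 h3 _ _ r.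
  + case=> w'' ne; rewrite /sheet_dist; congr mdist.
      have -> := projX_glue w'' (GlueY0 w' y0).
      rewrite /= ifN //; apply: contraNneq ne => ww.
      by apply/eqP; congr inl; exact/val_inj.
    by have -> := projY_glue w'' (GlueY0 w' y0).
  + by rewrite /sheet_dist [X in mdist X _]px projX_out // mdistxx.
  + rewrite /= eqxx projX_out //.
    apply: le_trans (dstar_triangle (cls (SheetX (extendY w' y0) eX)) _ _) _.
    by rewrite lerD ?dstar_edgeY //; exact: dstar_hop (HopX _ _ _).
- have [w' [x0 wE]] := WY_extendX w0; rewrite {}wE {w w0}.
  exists (SheetX w' (net_map (sval x0))).
  split=> //=; first by rewrite size_rcons.
  move=> q S E pq r; exists (inr (extendX w' x0)).
  have [h1 h2 h3] := edge_cond (inl x0) (SheetY (extendX w' x0) y)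
    (SheetX w' (net_map (sval x0))) q isT isT erefl pq.
  have py : projY (extendX w' x0) (SheetX w' (net_map (sval x0))) = eY.
    by rewrite (projY_glue _ (GlueX0 _ _)) /= gate_refl.
  apply: route_extend h1 h2 h3 _ _ r.
  + case=> w'' ne; rewrite /sheet_dist; congr mdist.
      by have -> := projX_glue w'' (GlueX0 w' x0).
    have -> := projY_glue w'' (GlueX0 w' x0).
    rewrite /= ifN //; apply: contraNneq ne => ww.
    by apply/eqP; congr inr; exact/val_inj.
  + by rewrite /sheet_dist [X in mdist X _]py projY_out // mdistxx.
  + rewrite /= eqxx projY_out //.
    apply: le_trans (dstar_triangle (cls (SheetY (extendX w' x0) eY)) _ _) _.
    by rewrite lerD ?dstar_edgeX //; exact: dstar_hop (HopY _ _ _).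
Qed.

Lemma edge_dist_same p q v :
  is_sheet p -> is_sheet q -> word p = word q -> edge_dist v p q = 0.
Proof.
move=> /height_sheet hp /height_sheet hq pq.
by rewrite /edge_dist !crossing_prefix // pq subrr normr0.
Qed.

(** A nonempty word ends in a letter of one kind only, so the two root sheets
    are the only two distinct sheets with the same word. *)
Lemma normal_both (w : WX) (w' : WY) :
  val w = val w' -> w = emptyX /\ w' = emptyY.
Proof.
move=> ww; suff w0 : val w = [::] by split; apply/val_inj; rewrite //= -ww.
case: w w' ww => /= w wP [w' w'P] /= ww; rewrite -{w'}ww in w'P.
move: wP w'P; case/lastP: w => // s l.
rewrite /ends_in_X /ends_in_Y !map_rcons !last_rcons.
by case: l => l /=; rewrite ?andbF.
Qed.

(** Off its own sheet, a point of a sheet projects as its word prescribes. *)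
Lemma sheet_dist_same s p q (S : seq sheet) :
  (forall w x, p = SheetX w x -> inl w \in S) ->
  (forall w x, q = SheetX w x -> inl w \in S) ->
  (forall w y, p = SheetY w y -> inr w \in S) ->
  (forall w y, q = SheetY w y -> inr w \in S) ->
  word p = word q -> s \notin S -> sheet_dist s p q = 0.
Proof.
move=> pX qX pY qY pq; case: s => w wS /=.
  have projE r : (forall w x, r = SheetX w x -> inl w \in S) ->
      projX w r = gate pointX eX (val w) (word r).
    case: r => //= w' x rX; case: eqP => // /val_inj ww.
    by move: wS; rewrite -ww (rX w' x).
  by rewrite !projE // pq mdistxx.
have projE r : (forall w x, r = SheetY w x -> inr w \in S) ->
    projY w r = gate pointY eY (val w) (word r).
  case: r => //= w' x rY; case: eqP => // /val_inj ww.
  by move: wS; rewrite -ww (rY w' x).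
by rewrite !projE // pq mdistxx.
Qed.

Lemma route_same_word p q : is_sheet p -> is_sheet q -> word p = word q ->
  exists S, route p q S [::].
Proof.
have routeXY x y : route (SheetX emptyX x) (SheetY emptyY y)
    [:: inl emptyX; inr emptyY] [::].
  split=> //; last first.
    rewrite !big_cons big_nil /= !addr0.
    apply: le_trans (dstar_triangle (cls (SheetX emptyX eX)) _ _) _.
    rewrite -addrA lerD ?(dstar_hop (HopX _ _ _)) //.
    apply: le_trans (dstar_triangle (cls (SheetY emptyY eY)) _ _) _.
    by rewrite addrC lerD ?dstar_edge_base ?(dstar_hop (HopY _ _ _)).
  split=> [s|v _]; last exact: edge_dist_same.
  by apply: sheet_dist_same => // w z [-> _]; rewrite !inE eqxx ?orbT.
case: p => [w x|w y|//|//|//] _; case: q => [w' x'|w' y'|//|//|//] _ /= ww.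
- have {w' ww}<- : w = w' by exact/val_inj.
  exists [:: inl w]; split=> //; last first.
    rewrite big_seq1 /= eqxx addr0; apply: le_trans (dstar_hop (HopX _ _ _)) _.
    by rewrite lerDl.
  split=> [s|v _]; last exact: edge_dist_same.
  by apply: sheet_dist_same => // ? ? [-> _]; rewrite inE eqxx.
- by have [-> ->] := normal_both ww; eexists; exact: routeXY.
- have [-> ->] := normal_both (esym ww); eexists; apply: route_sym.
  exact: routeXY.
- have {w' ww}<- : w = w' by exact/val_inj.
  exists [:: inr w]; split=> //; last first.
    rewrite big_seq1 /= eqxx addr0; apply: le_trans (dstar_hop (HopY _ _ _)) _.
    by rewrite lerDl.
  split=> [s|v _]; last exact: edge_dist_same.
  by apply: sheet_dist_same => // ? ? [-> _]; rewrite inE eqxx.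
Qed.

(** Induction on the total depth.  Of two sheets with different words, the
    deeper one does not separate the other from the root, so its point can be
    replaced by its parent. *)
Lemma route_exists p q : is_sheet p -> is_sheet q -> exists S E, route p q S E.
Proof.
have [n] := ubnP (size (word p) + size (word q)).
elim: n p q => // n IH p q; rewrite ltnS.
wlog qp : p q / (size (word q) <= size (word p))%N => [hw|] len ps qs.
  have [qp|/ltnW pq] := leqP (size (word q)) (size (word p)); first exact: hw.
  have [||//|//|S [E r]] := hw q p; rewrite 1?addnC //.
  by exists S, E; exact: route_sym.
have [pq|pq] := eqVneq (word p) (word q).
  by have [S r] := route_same_word ps qs pq; exists S, [::].
have p0 : word p != [::].
  apply: contraNneq pq => p0; move: qp; rewrite p0 leqn0 => /nilP ->.
  by [].
have [p' [p's lt next]] := sheet_parent ps p0.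
have lt_n : (size (word p') + size (word q) < n)%N.
  by apply: leq_trans len; rewrite ltn_add2r.
have [S [E r]] := IH p' q lt_n p's qs.
have npq : ~~ prefix (word p) (word q).
  by apply: contra pq; rewrite prefixE take_oversize // eq_sym.
have [s r'] := next _ _ _ npq r; by exists (s :: S), (word p :: E).
Qed.

End Tree.

(** * The embedding *)
Lemma sum_le_size (R : realType) (T : eqType) (s : seq T) (f : T -> R) c :
  (forall i, i \in s -> f i <= c) -> \sum_(i <- s) f i <= (size s)%:R * c.
Proof.
elim: s => [|a s IH] h; first by rewrite big_nil mul0r.
rewrite big_cons /= -natr1 mulrDl mul1r addrC lerD ?h ?inE ?eqxx //.
rewrite IH // => i si.
by rewrite h // inE si orbT.
Qed.

Section Embedding.
Context (R : realType) (X Y : metricType R) (NX : net X) (NY : net Y).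
Context (epsX : NX) (epsY : NY).
Context (HX HY : hilbertType R) (FX : X -> HX) (FY : Y -> HY).
Hypothesis FX_coarse : coarse_map (@mdist R X) FX.
Hypothesis FY_coarse : coarse_map (@mdist R Y) FY.

Local Notation letter := (letter epsX epsY).
Local Notation pre := (pre_product epsX epsY).
Local Notation fp := (free_product epsX epsY).
Local Notation sheet := (@sheet R X Y NX NY epsX epsY).
Local Notation origin := (SheetX (@emptyX R X Y NX NY epsX epsY) (net_base NX)).

Implicit Types (p q : pre) (P Q : fp) (v : seq letter).

Definition coord_space (i : sheet + seq letter) : hilbertType R :=
  match i with
  | inl (inl _) => HX
  | inl (inr _) => HY
  | inr _ => real_hilbert R
  end.

Definition coord (i : sheet + seq letter) p : coord_space i :=
  match i return coord_space i with
  | inl (inl w) => FX (projX w p)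
  | inl (inr w) => FY (projY w p)
  | inr v => crossing v p
  end.

Lemma coord_sheet_le r : exists c, forall s p q,
  sheet_dist s p q <= r -> `|coord (inl s) p - coord (inl s) q| <= c.
Proof.
have [cX cXP] := FX_coarse.1 r; have [cY cYP] := FY_coarse.1 r.
exists (Num.max cX cY) => -[w|w] p q /= pq; rewrite le_max.
  by rewrite cXP.
by rewrite cYP ?orbT.
Qed.

Lemma sheet_dist_le c : exists r, forall s p q,
  `|coord (inl s) p - coord (inl s) q| <= c -> sheet_dist s p q <= r.
Proof.
have [rX rXP] := FX_coarse.2 c; have [rY rYP] := FY_coarse.2 c.
exists (Num.max rX rY) => -[w|w] p q /= pq; rewrite le_max.
  by rewrite rXP.
by rewrite rYP ?orbT.
Qed.

Lemma coord_edge v p q : `|coord (inr v) p - coord (inr v) q| = edge_dist v p q.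
Proof. by []. Qed.

Definition route_support (S : seq sheet) (E : seq (seq letter)) :
    seq (sheet + seq letter) := map inl (undup S) ++ map inr E.

Lemma route_support_uniq S E : uniq E -> uniq (route_support S E).
Proof.
move=> uE; rewrite cat_uniq !map_inj_uniq; [|by move=> ? ? []|by move=> ? ? []].
rewrite undup_uniq uE andbT /=; apply/hasPn => _ /mapP[v _ ->].
by apply/negP => /mapP[].
Qed.

Lemma coord_route p q S E i : route p q S E -> i \notin route_support S E ->
  coord i p - coord i q = 0.
Proof.
move=> [_ _ _ [S0 E0] _]; rewrite mem_cat negb_or => /andP[iS iE].
case: i iS iE => [s|v] iS iE.
  have sS : s \notin S.
    by apply: contra iS => sS; apply/mapP; exists s; rewrite ?mem_undup.
  move: (S0 s sS); case: s {iS iE sS} => w /= /mdist_positivity ->;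
  by rewrite subrr.
have vE : v \notin E.
  by apply: contra iE => vE; apply/mapP; exists v.
by apply/eqP; rewrite -normr_eq0 coord_edge E0.
Qed.

Lemma sqsum_route p q S E : route p q S E ->
  (sqsum (fun i => (coord i p - coord i q)%R) <=
   (\sum_(i <- route_support S E) `|coord i p - coord i q| ^+ 2)%:E)%E.
Proof.
move=> r; apply: sqsum_supported => [|i].
  by case: r => uE *; exact: route_support_uniq.
exact: coord_route r.
Qed.

(** Every point is within distance 1 of a sheet, so it is enough to embed the
    points of the sheets, between which [route_exists] gives routes. *)
Definition nearby p : pre :=
  match p with
  | EdgeX w x0 _ => SheetX w (net_map (sval x0))
  | EdgeY w y0 _ => SheetY w (net_map (sval y0))
  | EdgeBase _ => origin
  | _ => p
  end.

Lemma nearby_sheet p : is_sheet (nearby p). Proof. by case: p. Qed.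

Lemma dstar_nearby p : dstar (cls p) (cls (nearby p)) <= 1.
Proof.
have norm_i01 (t : {i01 R}) : `|t%:num - 0| <= 1 :> R.
  by rewrite subr0 ger0_norm.
case: p => [w x|w y|w x0 t|w y0 t|t] /=.
- by apply: le_trans (dstar_hop (HopX _ _ _)) _; rewrite mdistxx.
- by apply: le_trans (dstar_hop (HopY _ _ _)) _; rewrite mdistxx.
- rewrite (cls_glue (GlueX0 _ _)).
  by apply: le_trans (dstar_hop (HopEdgeX _ _ _ _)) _; exact: norm_i01.
- rewrite (cls_glue (GlueY0 _ _)).
  by apply: le_trans (dstar_hop (HopEdgeY _ _ _ _)) _; exact: norm_i01.
- rewrite (cls_glue (GlueBaseX _ _)).
  by apply: le_trans (dstar_hop (HopEdgeBase _ _ _ _)) _; exact: norm_i01.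
Qed.

Let l2_finite_coord p :
  (sqsum (fun i => (coord i (nearby p) - coord i origin)%R) < +oo)%E.
Proof.
have [S [E r]] := route_exists (nearby_sheet p) (isT : is_sheet origin).
exact: le_lt_trans (sqsum_route r) (ltry _).
Qed.

(** Subtracting the coordinates of the origin makes the family finitely
    supported, by the route to the origin, and does not affect differences. *)
Definition embedding P : l2_hilbert coord_space :=
  L2 (l2_finite_coord (repr P)).

Local Notation rep P := (nearby (repr P)).

Lemma embeddingB P Q i :
  (embedding P - embedding Q : l2 coord_space) i =
  coord i (rep P) - coord i (rep Q).
Proof. by rewrite l2B /= opprB addrA subrK. Qed.

Lemma embedding_sqnorm P Q :
  (`|embedding P - embedding Q| ^+ 2)%:E =
  sqsum (fun i => (coord i (rep P) - coord i (rep Q))%R).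
Proof.
rewrite l2_norm2E -sqsumE; apply: eq_esum => i _.
by rewrite embeddingB.
Qed.

Lemma dstar_rep P : dstar P (cls (rep P)) <= 1.
Proof. by have := dstar_nearby (repr P); rewrite /cls reprK. Qed.

Lemma dstar_reps P Q :
  `|dstar P Q - dstar (cls (rep P)) (cls (rep Q))| <= 2.
Proof.
have hP := dstar_rep P; have hQ := dstar_rep Q.
have hP' : dstar (cls (rep P)) P <= 1 by rewrite dstar_sym.
have hQ' : dstar (cls (rep Q)) Q <= 1 by rewrite dstar_sym.
have h1 := dstar_triangle (cls (rep P)) P Q.
have h2 := dstar_triangle (cls (rep Q)) (cls (rep P)) Q.
have h3 := dstar_triangle P (cls (rep P)) (cls (rep Q)).
have h4 := dstar_triangle Q P (cls (rep Q)).
rewrite ler_norml; lra.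
Qed.

(** The constants come from [n <= r + 2], respectively [n <= c ^+ 2], for the
    number [n] of crossed edges, from the at most [n + 2] sheets of a route, and
    from the error of at most 2 caused by replacing both points by nearby points
    of sheets. *)
Lemma embedding_coarse : coarse_map (@dstar R X Y NX NY epsX epsY) embedding.
Proof.
split=> [r|c].
  have [c cP] := coord_sheet_le (r + 2).
  exists (Num.sqrt ((r + 4) * c ^+ 2 + (r + 2))) => P Q PQ.
  have := dstar_reps P Q; rewrite ler_norml => /andP[PQ2 _].
  have {PQ PQ2}pq : dstar (cls (rep P)) (cls (rep Q)) <= r + 2 by lra.
  have [S [E rSE]] :=
    route_exists (nearby_sheet (repr P)) (nearby_sheet (repr Q)).
  have [uE E1 SE _ _] := rSE.
  have sizeE : (size E)%:R <= r + 2.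
    apply: le_trans pq; apply: le_trans (crossings_le_dstar _ _ uE).
    rewrite big_seq; under eq_bigr => v vE do rewrite (E1 v vE).
    by rewrite -big_seq big_const_seq count_predT iter_addr_0.
  rewrite -[leLHS]ger0_norm // -sqrtr_sqr ler_wsqrtr //.
  rewrite -lee_fin embedding_sqnorm; apply: le_trans (sqsum_route rSE) _.
  rewrite lee_fin big_cat !big_map /=; apply: lerD.
    apply: (@le_trans _ _ ((size (undup S))%:R * c ^+ 2)).
      apply: sum_le_size => s _.
      have le_c : `|coord (inl s) (rep P) - coord (inl s) (rep Q)| <= c.
        by apply: cP; apply: le_trans pq; exact: sheet_dist_le_dstar.
      by rewrite ler_pXn2r ?nnegrE // (le_trans _ le_c).
    rewrite ler_wpM2r ?sqr_ge0 //; apply: (@le_trans _ _ (size E).+2%:R).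
      by rewrite ler_nat (leq_trans (size_undup _)).
    by rewrite -!natr1; lra.
  apply: le_trans sizeE; rewrite -[leRHS]mulr1; apply: sum_le_size => v vE.
  by rewrite coord_edge E1 // expr1n.
have [r rP] := sheet_dist_le c.
exists ((c ^+ 2 + 2) * r + c ^+ 2 + 3) => P Q PQ.
have := dstar_reps P Q; rewrite ler_norml => /andP[_ PQ2].
have c0 : 0 <= c by apply: le_trans PQ.
have sheet_r s : sheet_dist s (rep P) (rep Q) <= r.
  apply: rP; apply: le_trans PQ.
  by rewrite -embeddingB l2_coord_le.
have r0 : 0 <= r.
  by apply: le_trans (sheet_r (inl (emptyX _ _))); exact: sheet_dist_ge0.
have [S [E rSE]] :=
    route_exists (nearby_sheet (repr P)) (nearby_sheet (repr Q)).
have [uE E1 SE _ le_route] := rSE.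
have sizeE : (size E)%:R <= c ^+ 2.
  have uE' : uniq (map (@inr sheet (seq letter)) E).
    by rewrite map_inj_uniq // => ? ? [].
  apply: (@le_trans _ _ (`|embedding P - embedding Q| ^+ 2)); last first.
    by rewrite ler_pXn2r ?nnegrE.
  rewrite l2_norm2E; apply: le_trans (sqnorm_ge _ uE').
  rewrite big_map big_seq.
  under eq_bigr => v vE do rewrite embeddingB coord_edge (E1 v vE) expr1n.
  by rewrite -big_seq big_const_seq count_predT iter_addr_0.
have le_sheets : \sum_(s <- S) sheet_dist s (rep P) (rep Q) <= (c ^+ 2 + 2) * r.
  apply: (le_trans (sum_le_size (fun s _ => sheet_r s))).
  rewrite ler_wpM2r //; apply: (@le_trans _ _ (size E).+2%:R).
    by rewrite ler_nat.
  by rewrite -!natr1; lra.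
by lra.
Qed.

End Embedding.

Theorem theorem3p3 (R : realType) (X Y : metricType R)
    (NX : net X) (NY : net Y) (epsX : NX) (epsY : NY)
    (hepsX : net_map epsX = net_base NX) (hepsY : net_map epsY = net_base NY) :
  coarsely_embeddable (@mdist R X) ->
  coarsely_embeddable (@mdist R Y) ->
  coarsely_embeddable (@dstar R X Y NX NY epsX epsY).
Proof.
move=> /coarsely_embeddable_map[|HX [FX cX]]; first exact: mdist_ge0.
move=> /coarsely_embeddable_map[|HY [FY cY]]; first exact: mdist_ge0.
exact: coarse_map_embeddable (embedding_coarse epsX epsY cX cY).
Qed.
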